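(* Let $G$ be a subgroup of a right-angled Artin group and let $n$ be a non-negative integer. Then every maximal $n$-generated abelian subgroup of $G$ is left relatively convex in $G$.
   Context: A right-angled Artin group is a group with a presentation $\langle X\mid R\rangle$ where $X$ is a set (possibly infinite) and $R$ is a subset of the set of commutators $\{[x,y]=x^{-1}y^{-1}xy : x,y\in X\}$ in the free group on $X$. A maximal $n$-generated abelian subgroup of $G$ is a subgroup that is maximal, with respect to inclusion, among the abelian subgroups of $G$ that can be generated by $n$ elements. An order on a set is a transitive, trichotomous binary relation (a strict total order). A subgroup $H$ of a group $G$ is left relatively convex in $G$ if the left $G$-set $G/H$ of left cosets admits at least one $G$-invariant order. *)

(* Defs.v *)
From HB Require Import structures.
From mathcomp Require Import all_boot.
From mathcomp Require Import boolp classical_sets.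

Set Implicit Arguments.
Unset Strict Implicit.
Unset Printing Implicit Defensive.

Local Open Scope classical_set_scope.
Local Open Scope group_scope.

(* The free group on X is realized by the freely reduced words in the letters
   (x, true), standing for x, and (x, false), standing for x^-1. *)
Section FreeGroup.
Variable X : choiceType.

Local Notation letter := (X * bool)%type.
Implicit Types (a b : letter) (u v w : seq letter).

Definition flip a : letter := (a.1, ~~ a.2).

Definition reduced w := sorted (fun a b => b != flip a) w.

(* Left multiplication of a reduced word by one letter. *)
Definition push a w :=
  if w is b :: w' then if b == flip a then w' else a :: w else [:: a].

Definition word_mul u v := foldr push v u.

Definition word_inv u := rev (map flip u).

Lemma flipK : involutive flip.
Proof. by case=> x b; rewrite /flip /= negbK. Qed.

Lemma reduced_push a w : reduced w -> reduced (push a w).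
Proof.
case: w => [|b w] //= bw; case: ifPn => [_|ba]; last by rewrite /= ba.
exact: path_sorted bw.
Qed.

Lemma reduced_mul u v : reduced v -> reduced (word_mul u v).
Proof. by move=> rv; elim: u => //= a u; apply: reduced_push. Qed.

Lemma push_flip a w : reduced w -> push a (push (flip a) w) = w.
Proof.
case: w => [|b w] /=; first by rewrite eqxx.
rewrite flipK; case: eqP => [->|_] /=; last by rewrite eqxx.
by case: w => //= c w /andP[/negPf ->].
Qed.

Lemma word_mul_push a u v : reduced v ->
  word_mul (push a u) v = push a (word_mul u v).
Proof.
case: u => [|b u] //= rv; case: eqP => [->|//] /=.
by rewrite push_flip //; apply: reduced_mul.
Qed.

Lemma word_mulA u v w : reduced w ->
  word_mul u (word_mul v w) = word_mul (word_mul u v) w.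
Proof. by move=> rw; elim: u => //= a u ->; rewrite word_mul_push. Qed.

Lemma word_mul0 u : reduced u -> word_mul u [::] = u.
Proof.
elim: u => //= a u IHu au; rewrite IHu; last exact: path_sorted au.
by case: u au {IHu} => //= b u /andP[/negPf ->].
Qed.

Lemma reduced_inv u : reduced u -> reduced (word_inv u).
Proof.
rewrite /reduced /word_inv rev_sorted sorted_map.
apply: sub_sorted => a b /=; apply: contra => /eqP.
by rewrite flipK => ->.
Qed.

Lemma word_invK u : word_inv (word_inv u) = u.
Proof. by rewrite /word_inv map_rev revK mapK //; apply: flipK. Qed.

Lemma word_mulV u : word_mul (word_inv u) u = [::].
Proof.
elim: u => //= a u IHu.
by rewrite /word_inv /= rev_cons /word_mul foldr_rcons /= flipK eqxx.
Qed.

Record free_group := FreeGroup { free_word :> seq letter; _ : reduced free_word }.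

HB.instance Definition _ := [isSub for free_word].
HB.instance Definition _ := [Choice of free_group by <:].

Implicit Types g h : free_group.

Definition free_one := FreeGroup (isT : reduced [::]).
Definition free_mul g h := FreeGroup (reduced_mul g (valP h)).
Definition free_inv g := FreeGroup (reduced_inv (valP g)).

Lemma free_mulA : associative free_mul.
Proof. by move=> g h k; apply/val_inj/word_mulA/valP. Qed.

Lemma free_mul1 : left_id free_one free_mul.
Proof. by move=> g; apply/val_inj. Qed.

Lemma free_mulr1 : right_id free_one free_mul.
Proof. by move=> g; apply/val_inj/word_mul0/valP. Qed.

Lemma free_mulV : left_inverse free_one free_inv free_mul.
Proof. by move=> g; apply/val_inj/word_mulV. Qed.

Lemma free_mulrV : right_inverse free_one free_inv free_mul.
Proof.
by move=> g; apply/val_inj; rewrite /= -{1}(word_invK g); apply: word_mulV.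
Qed.

HB.instance Definition _ := isGroup.Build free_group
  free_mulA free_mul1 free_mulr1 free_mulV free_mulrV.

Definition free_gen (x : X) : free_group :=
  FreeGroup (isT : reduced [:: (x, true)]).

End FreeGroup.

Section Subgroups.
Variable T : groupType.
Implicit Types (G H K N S : set T).

Definition is_subgroup H := group_closed (mem H).

Definition is_normal_subgroup N :=
  is_subgroup N /\ forall g x : T, N x -> N (x ^ g).

Definition generated S : set T := smallest is_subgroup S.

Definition normal_closure S : set T := smallest is_normal_subgroup S.

Definition abelian_subgroup H :=
  is_subgroup H /\ forall x y, H x -> H y -> commute x y.

(* The listed generators may repeat, so this is generation by at most n
   elements. *)
Definition n_generated n H :=
  exists s : n.-tuple T, H = generated [set x | x \in s].

Definition n_generated_abelian_in G n H :=
  [/\ H `<=` G, abelian_subgroup H & n_generated n H].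

Definition maximal_n_generated_abelian G n H :=
  n_generated_abelian_in G n H /\
  forall K, n_generated_abelian_in G n K -> H `<=` K -> K = H.

Definition left_coset (g : T) S : set T := [set g * x | x in S].

Definition left_cosets G H : set (set T) := [set left_coset g H | g in G].

End Subgroups.

Definition transitive_on {U : Type} (D : set U) (lt : U -> U -> Prop) :=
  forall x y z, D x -> D y -> D z -> lt x y -> lt y z -> lt x z.

Definition trichotomous_on {U : Type} (D : set U) (lt : U -> U -> Prop) :=
  forall x y, D x -> D y ->
    [\/ [/\ lt x y, x <> y & ~ lt y x],
        [/\ ~ lt x y, x = y & ~ lt y x]
      | [/\ ~ lt x y, x <> y & lt y x]].

(* The action of g on a left coset C = xH is left translation: gC = (gx)H. *)
Definition left_relatively_convex (T : groupType) (G H : set T) :=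
  [/\ is_subgroup H, H `<=` G &
    exists lt : set T -> set T -> Prop,
      [/\ transitive_on (left_cosets G H) lt,
          trichotomous_on (left_cosets G H) lt &
          forall g C D, G g -> left_cosets G H C -> left_cosets G H D ->
            lt C D -> lt (left_coset g C) (left_coset g D)]].

(* A has a presentation with generating set X and relators R: it is the image
   of the free group on X under a morphism whose kernel is the normal closure
   of R. *)
Definition has_presentation (A : groupType) (X : choiceType)
    (R : set (free_group X)) :=
  exists phi : {multiplicative free_group X -> A},
    (forall a : A, exists w, phi w = a) /\
    [set w | phi w = 1] = normal_closure R.

Definition right_angled_artin (A : groupType) :=
  exists (X : choiceType) (R : set (free_group X)),
    (forall r, R r -> exists x y : X, r = [~ free_gen x, free_gen y]) /\
    has_presentation A R.

(* Main.v *)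
(* The Burns-Hale argument: by compactness it is enough to choose, for every
   finite list F of elements of G outside H, signs such that the semigroup
   generated by H and the signed elements of F avoids H. Let K = <H, F> and let
   L be the isolator of H[K, K] in K. Since K/L is torsion-free abelian, the
   elements of F outside L can be given signs, and those in L are treated by
   induction, unless F lies in L, i.e. unless L = K. A right-angled Artin group
   has a central series with torsion-free factors and trivial intersection, and
   this forces K to be abelian when L = K. Then some power map embeds K into H,
   so K is generated by n elements and K = H by maximality, a contradiction.

   The central series comes from the Magnus map x |-> 1 + x into power series
   over the trace monoid: it is the filtration by the order of vanishing of
   g - 1. The Magnus map is injective because the coefficient of the trace
   x1 ... xk in the image of a reduced product of syllables
   x1^e1 ... xk^ek is e1 ... ek. *)
Require Import Defs.
From mathcomp Require Import all_boot all_order all_algebra.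
From mathcomp Require Import boolp classical_sets functions.

Set Implicit Arguments.
Unset Strict Implicit.
Unset Printing Implicit Defensive.

Import Order.TTheory GRing.Theory Num.Theory.

Local Open Scope classical_set_scope.
Local Open Scope group_scope.

(** * Orders on cosets from finite sign choices *)

Section SubgroupTheory.
Variable T : groupType.
Implicit Types (G H K N S : set T) (x y : T).

Lemma is_subgroupP H :
  is_subgroup H <-> H 1 /\ forall x y, H x -> H y -> H (x / y).
Proof.
split=> [[]|[H1 HB]].
  by rewrite in_setE => H1 HB; split=> // x y /mem_set Hx /mem_set Hy;
    apply/set_mem/HB.
split; first exact: mem_set.
by move=> x y /set_mem Hx /set_mem Hy; apply/mem_set/HB.
Qed.

Lemma subgroup1 H : is_subgroup H -> H 1.
Proof. by case/is_subgroupP. Qed.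

Lemma subgroupV H x : is_subgroup H -> H x -> H x^-1.
Proof. by case/is_subgroupP=> H1 HB /(HB 1 _ H1); rewrite mul1g. Qed.

Lemma subgroupM H x y : is_subgroup H -> H x -> H y -> H (x * y).
Proof.
move=> sH Hx /(subgroupV sH) Hy; case/is_subgroupP: sH => _ /(_ _ _ Hx Hy).
by rewrite invgK.
Qed.

Lemma subgroupB H x y : is_subgroup H -> H x -> H y -> H (x / y).
Proof. by case/is_subgroupP=> _; apply. Qed.

Lemma subgroupR H x y : is_subgroup H -> H x -> H y -> H [~ x, y].
Proof.
move=> sH Hx Hy; apply: subgroupM => //; first exact: subgroupV.
by apply: subgroupM => //; [apply: subgroupV|apply: subgroupM].
Qed.

Lemma subgroupX H x n : is_subgroup H -> H x -> H (x ^+ n).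
Proof.
move=> sH Hx; elim: n => [|n IHn]; first exact: subgroup1.
by rewrite expgS; apply: subgroupM.
Qed.

Lemma subgroupMr H x y : is_subgroup H -> H x -> H (y * x) -> H y.
Proof.
by move=> sH Hx /subgroupM-/(_ x^-1 sH (subgroupV sH Hx)); rewrite mulgK.
Qed.

Lemma subgroupMl H x y : is_subgroup H -> H x -> H (x * y) -> H y.
Proof.
by move=> sH Hx /(subgroupM sH (subgroupV sH Hx)); rewrite mulKg.
Qed.

Lemma subgroup_generated S : is_subgroup (generated S).
Proof.
apply/is_subgroupP; split=> [K [/subgroup1 //]|x y gx gy K KP].
by case/is_subgroupP: (KP.1) => _; apply; [apply: gx|apply: gy].
Qed.

Lemma generated1 S : generated S 1.
Proof. exact: subgroup1 (subgroup_generated S). Qed.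

Lemma sub_generated S : S `<=` generated S.
Proof. exact: sub_gen_smallest. Qed.

Lemma generated_sub S H : is_subgroup H -> S `<=` H -> generated S `<=` H.
Proof. exact: smallest_sub. Qed.

End SubgroupTheory.

Section LocalOrder.
Variable T : groupType.
Implicit Types (G H P S : set T) (E F : seq T) (x y : T).

(** The model is the set of x with H < xH for an invariant order on cosets; closure under H on both
    sides makes the resulting order independent of representatives. *)
Definition positive_cone H P :=
  [/\ forall x, P x -> ~ H x, forall x y, P x -> P y -> P (x * y)
    & forall h x, H h -> P x -> P (h * x) /\ P (x * h)].

Definition orients P F := forall x, x \in F -> P x \/ P x^-1.

Definition locally_orientable G H :=
  forall F, (forall x, x \in F -> G x /\ ~ H x) ->
    exists P, positive_cone H P /\ orients P F.

(** A finitary substitute for lying in a total cone: only finite parts of S are tested, so the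
    property passes to unions of nonempty chains and Zorn's lemma applies. *)
Let extendable G H S := S `<=` G /\
  forall E F, (forall x, x \in E -> S x) ->
    (forall x, x \in F -> G x /\ ~ H x) ->
    exists P, [/\ positive_cone H P, forall x, x \in E -> P x & orients P F].

Lemma extendable_maximal G H : locally_orientable G H ->
  exists S, extendable G H S /\ forall S', S `<` S' -> ~ extendable G H S'.
Proof.
move=> locGH; apply: Zorn_bigcup => C CP totC; split.
  by move=> x [S /CP[SG _] /SG].
(* The chain may be empty, so one of its members is available only when E is nonempty; for empty E
   local orientability suffices. *)
move=> E F ES FG; have [->|[x0 x0E]] : E = [::] \/ exists x, x \in E.
- by case: E {ES} => [|x E]; [left|right; exists x; rewrite inE eqxx].
- by have [P [cP oP]] := locGH F FG; exists P; split.
suff [S [CS SE]] : exists S, C S /\ forall x, x \in E -> S x.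
  by have [_] := CP S CS; apply.
have [S0 CS0 _] := ES x0 x0E.
elim: E ES {x0E} => [|x E IHE] ES; first by exists S0.
have [x' x'E|S [CS SE]] := IHE; first by apply: ES; rewrite inE x'E orbT.
have [|S' CS' S'x] := ES x; first by rewrite inE eqxx.
have [SS'|S'S] := totC S S' CS CS'.
  by exists S'; split=> // y; rewrite inE => /predU1P[->|/SE/SS'].
by exists S; split=> // y; rewrite inE => /predU1P[->|/SE]; first exact: S'S.
Qed.

(** By maximality, adding x to S destroys extendability, and such a failure is always witnessed by
    finite lists. *)
Lemma sub_maximal_extendable G H S x : is_subgroup G -> is_subgroup H ->
  extendable G H S -> (forall S', S `<` S' -> ~ extendable G H S') ->
  G x -> ~ S x -> exists E F, [/\ forall y, y \in E -> S y \/ y = x,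
    forall y, y \in F -> G y /\ ~ H y &
    forall P, positive_cone H P -> (forall y, y \in E -> P y) ->
       orients P F -> False].
Proof.
move=> sG sH eS maxS Gx nSx; apply: contrapT => nE.
apply: (maxS (S `|` [set x])).
  split; first by move=> y Sy; left.
  by move=> /(_ x (or_intror (erefl x))).
split=> [y [/(proj1 eS)//|-> //]|E F ES FG]; apply: contrapT => nP.
apply: nE; exists E, F; split=> // P cP EP oP.
by apply: nP; exists P.
Qed.

Lemma positive_cone_of_local G H : is_subgroup G -> is_subgroup H ->
  locally_orientable G H -> exists S, [/\ S `<=` G, positive_cone (H `&` G) S
    & forall x, G x -> ~ H x -> S x \/ S x^-1].
Proof.
move=> sG sH /extendable_maximal[S [eS maxS]]; exists S.
have [SG extS] := eS.
have totS x : G x -> ~ H x -> S x \/ S x^-1.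
  move=> Gx Hx; apply: contrapT => /not_orP[Sx SVx].
  have [E1 [F1 [ES1 FG1 nP1]]] := sub_maximal_extendable sG sH eS maxS Gx Sx.
  have [E2 [F2 [ES2 FG2 nP2]]] :=
    sub_maximal_extendable sG sH eS maxS (subgroupV sG Gx) SVx.
  (* Removing x from [E1] and x^-1 from [E2] leaves only elements of S. A cone containing these and
     giving a sign to x contradicts one of the two obstructions. *)
  pose E := [seq y <- E1 | y != x] ++ [seq y <- E2 | y != x^-1].
  have [||P [cP EP oP]] := extS E (x :: F1 ++ F2).
  - move=> y; rewrite mem_cat !mem_filter => /orP[]/andP[/eqP yx yE].
      by have [] := ES1 y yE.
    by have [] := ES2 y yE.
  - by move=> y; rewrite inE mem_cat => /predU1P[->//|/orP[/FG1|/FG2]].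
  have [|Px|Px] := oP x; first by rewrite inE eqxx.
    apply: (nP1 P) => // [y yE|y yF].
      have [->//|yx] := eqVneq y x.
      by apply: EP; rewrite mem_cat mem_filter yx yE.
    by apply: oP; rewrite inE mem_cat yF orbT.
  apply: (nP2 P) => // [y yE|y yF].
    have [->//|yx] := eqVneq y x^-1.
    by apply: EP; rewrite mem_cat !mem_filter yx yE orbT.
  by apply: oP; rewrite inE mem_cat yF !orbT.
(* Each closure property only involves finitely many elements of S, and it
   holds in a cone extending those. *)
have closedS x E : G x -> (forall y, y \in E -> S y) ->
    (forall P, positive_cone H P -> (forall y, y \in E -> P y) -> P x) -> S x.
  move=> Gx ES EP.
  have nHx : ~ H x.
    have [//|P [cP /(EP P cP) Px _]] := extS E [::] ES _.
    by case: cP => /(_ x Px).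
  have [//|SVx] := totS x Gx nHx.
  have [|//|P [cP EVP _]] := extS (x^-1 :: E) [::] _ _.
    by move=> y; rewrite inE => /predU1P[->|/ES].
  have Px : P x by apply: EP => // y yE; apply: EVP; rewrite inE yE orbT.
  have PVx : P x^-1 by apply: EVP; rewrite inE eqxx.
  case: cP => PH PM _; case: (PH (x * x^-1)); first exact: PM.
  by rewrite mulgV; apply: subgroup1.
split=> //; split.
- move=> x Sx [Hx _]; have [|//|P [[PH _ _] EP _]] := extS [:: x] [::] _ _.
    by move=> y; rewrite inE => /eqP->.
  by apply: (PH x) => //; apply: EP; rewrite inE eqxx.
- move=> x y Sx Sy; apply: (closedS _ [:: x; y]).
  + by apply: subgroupM => //; apply: SG.
  + by move=> z; rewrite !inE => /orP[]/eqP->.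
  by move=> P [_ PM _] EP; apply: PM; apply: EP; rewrite !inE eqxx ?orbT.
move=> h x [Hh Gh] Sx; split; apply: (closedS _ [:: x]).
- by apply: subgroupM => //; apply: SG.
- by move=> z; rewrite !inE => /eqP->.
- by move=> P [_ _ PH] EP; apply: (PH h x Hh _).1; apply: EP; rewrite inE.
- by apply: subgroupM => //; apply: SG.
- by move=> z; rewrite !inE => /eqP->.
by move=> P [_ _ PH] EP; apply: (PH h x Hh _).2; apply: EP; rewrite inE.
Qed.

Lemma left_coset_eq H x y : is_subgroup H ->
  left_coset x H = left_coset y H <-> H (x^-1 * y).
Proof.
move=> sH; split=> [eqxy|Hxy].
  have : left_coset y H y by exists 1; [apply: subgroup1|rewrite mulg1].
  by rewrite -eqxy => -[h Hh <-]; rewrite mulKg.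
apply/seteqP; split=> _ [h Hh <-].
  exists ((x^-1 * y)^-1 * h); first by apply: subgroupM => //; apply: subgroupV.
  by rewrite invgM invgK -!mulgA mulVKg.
exists (x^-1 * y * h); first exact: subgroupM.
by rewrite -!mulgA mulVKg.
Qed.

Lemma left_cosetM H x y : left_coset x (left_coset y H) = left_coset (x * y) H.
Proof.
apply/seteqP; split=> [_ [_ [h Hh <-] <-]|_ [h Hh <-]].
  by exists h; rewrite ?mulgA.
by exists (y * h); [exists h|rewrite mulgA].
Qed.

(** The order puts xH below yH when x^-1 y lies in the cone; left translations cancel in x^-1 y,
    which gives invariance. *)
Theorem left_relatively_convex_local G H :
  is_subgroup G -> is_subgroup H -> H `<=` G ->
  locally_orientable G H -> left_relatively_convex G H.
Proof.
move=> sG sH HG /(positive_cone_of_local sG sH)[S [SG]].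
have -> : H `&` G = H by apply/setIidPl.
case=> SH SM SHM totS; split=> //.
pose lt C D := exists x y,
  [/\ G x, G y, C = left_coset x H, D = left_coset y H & S (x^-1 * y)].
have ltP x y : G x -> G y ->
    lt (left_coset x H) (left_coset y H) <-> S (x^-1 * y).
  move=> Gx Gy; split; last by exists x, y.
  case=> [x' [y' [_ _ /(left_coset_eq _ _ sH) Hx /(left_coset_eq _ _ sH) Hy]]].
  move=> /SHM-/(_ _ Hx)[/SHM-/(_ _ (subgroupV sH Hy))[_]] + _.
  by rewrite invgM invgK -!mulgA !mulVKg.
exists lt; split.
- move=> _ _ _ [x Gx <-] [y Gy <-] [z Gz <-] /(ltP _ _ Gx Gy) Sxy.
  move=> /(ltP _ _ Gy Gz)/(SM _ _ Sxy) Sxz; apply/ltP => //.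
  by move: Sxz; rewrite -mulgA mulVKg.
- move=> _ _ [x Gx <-] [y Gy <-].
  have asym z : S z -> ~ S z^-1.
    move=> Sz /(SM _ _ Sz); rewrite mulgV => /SH; apply; exact: subgroup1.
  have Vxy : (x^-1 * y)^-1 = y^-1 * x by rewrite invgM invgK.
  have [Hxy|Hxy] := pselect (H (x^-1 * y)).
    apply: Or32; split; last 1 first.
    + move=> /(ltP _ _ Gy Gx)/SH; apply.
      by rewrite -Vxy; apply: subgroupV.
    + by move=> /(ltP _ _ Gx Gy)/SH.
    by apply/left_coset_eq.
  have neq : left_coset x H <> left_coset y H by move/left_coset_eq => /(_ sH).
  have [|Sxy|Sxy] := totS (x^-1 * y) _ Hxy.
  + by apply: subgroupM => //; apply: subgroupV.
  + apply: Or31; split=> //; first by apply/ltP.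
    by move=> /(ltP _ _ Gy Gx); rewrite -Vxy; apply: asym.
  apply: Or33; split=> //; last by apply/ltP => //; rewrite -Vxy.
  by move=> /(ltP _ _ Gx Gy)/asym.
move=> g _ _ Gg [x Gx <-] [y Gy <-] /(ltP _ _ Gx Gy) Sxy.
rewrite !left_cosetM; apply/ltP; [exact: subgroupM|exact: subgroupM|].
by rewrite invgM -!mulgA mulKg.
Qed.

End LocalOrder.

(** * Torsion-free abelian quotients *)

Section Congruence.
Variables (T : groupType) (K L : set T).
Hypotheses (sK : is_subgroup K) (sL : is_subgroup L) (LK : L `<=` K).
Hypothesis commL : forall x y, K x -> K y -> L [~ x, y].
Implicit Types (x y z : T).

(** This is equality in the abelian group K/L, which is not formed as a quotient. *)
Local Notation "x =m y" := (L (x^-1 * y)) (at level 70).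

Lemma eqm_refl x : x =m x.
Proof. by rewrite mulVg; apply: subgroup1. Qed.

Lemma eqm_sym x y : x =m y -> y =m x.
Proof. by move=> /(subgroupV sL); rewrite invgM invgK. Qed.

Lemma eqm_trans y x z : x =m y -> y =m z -> x =m z.
Proof. by move=> xy /(subgroupM sL xy); rewrite -mulgA mulVKg. Qed.

Lemma eqm_mem x y : x =m y -> L x -> L y.
Proof. by move=> xy /subgroupM-/(_ _ sL xy); rewrite mulVKg. Qed.

(** Conjugating an element of L by y changes it by a commutator, which lies in L; so K normalizes
    L. *)
Lemma eqmM x x' y y' : K y -> x =m x' -> y =m y' -> x * y =m x' * y'.
Proof.
move=> Ky xx' yy'.
have -> : (x * y)^-1 * (x' * y') = (x^-1 * x') ^ y * (y^-1 * y').
  by rewrite invgM conjgE -!mulgA mulVKg.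
apply: subgroupM => //; rewrite -[_ ^ y](mulVKg (x^-1 * x')) -commgEl.
by apply: subgroupM => //; apply: commL => //; apply: LK.
Qed.

Lemma eqmC x y : K x -> K y -> x * y =m y * x.
Proof. by move=> Kx Ky; rewrite invgM -mulgA; apply: commL. Qed.

Lemma eqmAC x y z : K x -> K y -> K z -> x * y * z =m x * z * y.
Proof.
move=> Kx Ky Kz; rewrite -!mulgA; refine (eqmM _ (eqm_refl x) (eqmC Ky Kz)).
exact: subgroupM.
Qed.

Lemma eqmACA x y z t : K x -> K y -> K z -> K t ->
  x * y * (z * t) =m x * z * (y * t).
Proof.
move=> Kx Ky Kz Kt; rewrite [x * y * _]mulgA [x * z * _]mulgA.
by apply: eqmM => //; [apply: eqmAC|apply: eqm_refl].
Qed.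

Lemma eqm_expgMn x y n : K x -> K y -> (x * y) ^+ n =m x ^+ n * y ^+ n.
Proof.
move=> Kx Ky; elim: n => [|n IHn]; first by rewrite mulg1; apply: eqm_refl.
rewrite !expgS; apply: eqm_trans (eqmACA _ _ _ _) => //; last first.
- exact: subgroupX.
- exact: subgroupX.
apply: eqmM _ (eqm_refl _) IHn.
by apply: subgroupX => //; apply: subgroupM.
Qed.

(** This is the preimage of the torsion subgroup of K/L; the product of two exponents serves for a
    quotient of two elements. *)
Lemma isolator_subgroup :
  is_subgroup [set x | K x /\ exists2 n, 0 < n & L (x ^+ n)].
Proof.
apply/is_subgroupP; split.
  by split; [apply: subgroup1|exists 1%N => //; apply: subgroup1].
move=> x y [Kx [n n0 Lx]] [Ky [m m0 Ly]]; split.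
  by apply: subgroupM => //; apply: subgroupV.
exists (n * m)%N; first by rewrite muln_gt0 n0.
have KVy := subgroupV sK Ky.
apply: (eqm_mem (eqm_sym (eqm_expgMn _ Kx KVy))).
rewrite expgnA mulnC expgnA expVgn expVgn.
by apply: subgroupM => //; [|apply: subgroupV => //]; apply: subgroupX.
Qed.

Hypothesis isolL : forall x n, K x -> 0 < n -> L (x ^+ n) -> L x.

Lemma positive_cone_expg P y n : positive_cone L P -> 0 < n ->
  P y -> P (y ^+ n).
Proof.
move=> [_ PM _]; case: n => // n _ Py.
by elim: n => // n IHn; rewrite expgS; apply: PM.
Qed.

(** For a cone P in K, this is the semigroup generated by f and P, saturated by L. Requiring n > 0
    when y lies in L keeps L itself from being included from the start. *)
Let adjoin P f := [set x | exists n y,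
  [/\ (0 < n)%N /\ L y \/ P y, K y & f ^+ n * y =m x]].

Lemma adjoin_sub P f x : K f -> adjoin P f x -> K x.
Proof.
move=> Kf [n [y [_ Ky /LK]]]; apply: subgroupMl => //; apply: subgroupV => //.
by apply: subgroupM => //; apply: subgroupX.
Qed.

Lemma adjoinP P f : K f -> P `<=` K -> positive_cone L P ->
  (forall x, adjoin P f x -> ~ L x) -> positive_cone L (adjoin P f).
Proof.
move=> Kf PK [PL PM PHM] adjL.
have Kpow n y : K y -> K (f ^+ n * y).
  by move=> Ky; apply: subgroupM => //; apply: subgroupX.
split=> //.
  move=> x x' [n [y [Py Ky eqx]]] [n' [y' [Py' Ky' eqx']]].
  exists (n + n')%N, (y * y'); split; last 2 first.
  - exact: subgroupM.
  - rewrite expgnDr; apply: (@eqm_trans ((f ^+ n * y) * (f ^+ n' * y'))).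
      by apply: eqmACA => //; apply: subgroupX.
    by apply: eqmM => //; apply: Kpow.
  case: Py Py' => [[n0 Ly]|Py] [[n0' Ly']|Py'].
  - by left; rewrite addn_gt0 n0; split=> //; apply: subgroupM.
  - by right; apply: (PHM _ _ _ _).1.
  - by right; apply: (PHM _ _ _ _).2.
  by right; apply: PM.
have adjE x x' : adjoin P f x -> x =m x' -> adjoin P f x'.
  move=> [n [y [Py Ky eqx]]] xx'; exists n, y; split=> //.
  exact: eqm_trans xx'.
move=> h x Lh adjx; have Kx := adjoin_sub Kf adjx.
suff xh : x =m x * h.
  split; last exact: adjE xh.
  by apply: adjE adjx (eqm_trans xh _); apply: eqmC => //; apply: LK.
by rewrite mulKg.
Qed.

(* If neither sign of f works then f^n y and f^-m z lie in L for some
   n, m > 0, and so does y^m z^n. *)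
Lemma orients_cons P f : K f -> ~ L f -> P `<=` K -> positive_cone L P ->
  exists P', [/\ P `<=` P', P' `<=` K, positive_cone L P' & P' f \/ P' f^-1].
Proof.
move=> Kf nLf PK cP; have [PL PM PHM] := cP.
have KVf := subgroupV sK Kf.
have memf g : K g -> adjoin P g g.
  move=> Kg; exists 1%N, 1; split; [|exact: subgroup1|].
    by left; split=> //; apply: subgroup1.
  by rewrite mulg1; apply: eqm_refl.
have subP g : P `<=` adjoin P g.
  move=> x Px; exists 0%N, x; split; [by right|exact: PK|].
  by rewrite mul1g; apply: eqm_refl.
have [adjL|] := pselect (forall x, adjoin P f x -> ~ L x).
  exists (adjoin P f); split=> //; last by left; apply: memf.
    by move=> x; apply: adjoin_sub.
  exact: adjoinP.
have [adjL _|] := pselect (forall x, adjoin P f^-1 x -> ~ L x).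
  exists (adjoin P f^-1); split=> //; last by right; apply: memf.
    by move=> x; apply: adjoin_sub.
  exact: adjoinP.
have inL g : K g -> ~ (forall x, adjoin P g x -> ~ L x) ->
    exists n y, [/\ 0 < n, L y \/ P y, K y & L (g ^+ n * y)].
  move=> Kg; rewrite -existsNE => -[x].
  move=> /not_implyP[[n [y [Py Ky eqx]]] /contrapT Lx].
  have Lgy : L (g ^+ n * y) by apply: eqm_mem Lx; apply: eqm_sym.
  exists n, y; split=> //; last by case: Py => [[]|]; [left|right].
  case: n Lgy {eqx} Py => // Ly [[]//|Py].
  by case: (PL y) => //; rewrite -[y]mul1g.
move=> /(inL _ KVf)[m [z [m0 Pz Kz Lz]]] /(inL _ Kf)[n [y [n0 Py Ky Ly]]].
(* In (f^n y)^m (f^-m z)^n the powers of f cancel modulo L. *)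
have Lyz : L (y ^+ m * z ^+ n).
  have KX g k : K g -> K (g ^+ k) by apply: subgroupX.
  have := subgroupM sL (subgroupX m sL Ly) (subgroupX n sL Lz).
  apply: eqm_mem; apply: eqm_trans.
    apply: eqmM (eqm_expgMn m _ Ky) (eqm_expgMn n _ Kz); do ?exact: KX.
    exact: KX (subgroupM sK (KX _ _ KVf) Kz).
  apply: eqm_trans; first by apply: eqmACA; do ?apply/KX.
  by rewrite -!expgnA [(m * n)%N]mulnC expVgn mulgV mul1g; apply: eqm_refl.
have signX x k : 0 < k -> L x \/ P x -> L (x ^+ k) \/ P (x ^+ k).
  by move=> k0 [?|?]; [left; apply: subgroupX|right; apply: positive_cone_expg].
(* If y were in P, then y^m would be in P, and y^m z^n would lie in both P and L or y^m itself
   would. So y lies in L, hence so does f^n, and isolation puts f in L. *)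
have [Ly'|Py'] := signX _ _ m0 Py; last first.
  case: (PL _ _ Lyz); have [Lz'|Pz'] := signX _ _ n0 Pz.
    exact: (PHM _ _ _ _).2.
  exact: PM.
case: Py Ly => [Ly|Py _]; last first.
  by case: (PL (y ^+ m)) => //; apply: positive_cone_expg.
by move=> /(subgroupMr sL Ly)/isolL-/(_ Kf n0).
Qed.

Lemma orientable_isolated F : (forall x, x \in F -> K x /\ ~ L x) ->
  exists P, [/\ P `<=` K, positive_cone L P & orients P F].
Proof.
elim: F => [|f F IHF] FK; first by exists set0; split=> //; split.
have [x xF|P [PK cP oP]] := IHF; first by apply: FK; rewrite inE xF orbT.
have [|Kf nLf] := FK f; first by rewrite inE eqxx.
have [P' [PP' P'K cP' oP']] := orients_cons Kf nLf PK cP.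
exists P'; split=> // x; rewrite inE => /predU1P[->//|/oP].
by case=> /PP'; [left|right].
Qed.

End Congruence.

(** Elements of F outside L receive signs from K/L. Those in L form a strictly shorter list, because
    some g in F lies outside L, and are treated by induction. *)
Lemma locally_orientable_of_isolated (T : groupType) (G H : set T) :
  is_subgroup G -> is_subgroup H -> H `<=` G ->
  (forall (F : seq T) f, f \in F -> (forall x, x \in F -> G x /\ ~ H x) ->
    let K := generated (H `|` [set` F]) in
    exists L, [/\ is_subgroup L, H `<=` L /\ L `<=` K,
      forall x y, K x -> K y -> L [~ x, y],
      forall x n, K x -> 0 < n -> L (x ^+ n) -> L x &
      exists2 g, g \in F & ~ L g]) ->
  locally_orientable G H.
Proof.
move=> sG sH HG isol F; have [k] := ubnP (size F).
elim: k F => // k IHk F; rewrite ltnS => Fk FG.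
have [->|[f fF]] : F = [::] \/ exists f, f \in F.
- by case: F {Fk FG} => [|f F]; [left|right; exists f; rewrite inE eqxx].
- by exists set0; split=> //; split.
have [] := isol F f fF FG; set K := generated _.
move=> L [sL [HL LK] commL isolL [g gF nLg]].
have sK : is_subgroup K by apply: subgroup_generated.
have FK x : x \in F -> K x by move=> xF; apply: sub_generated; right.
pose F0 := [seq x <- F | x \in L]; pose F1 := [seq x <- F | x \notin L].
have [||P0 [[P0H P0M P0HM] oP0]] := IHk F0.
- apply: leq_trans Fk; rewrite size_filter -(count_predC (mem L) F).
  rewrite -[X in (X < _)%N]addn0 ltn_add2l -has_count.
  by apply/hasP; exists g => //=; apply/negP; rewrite in_setE.
- by move=> x; rewrite mem_filter => /andP[_ /FG].
have [|P1 [P1K [P1L P1M P1HM] oP1]] :=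
    orientable_isolated sK sL LK commL isolL (F := F1).
  move=> x; rewrite mem_filter => /andP[Lx xF]; split; first exact: FK.
  by move=> /mem_set Lx'; rewrite Lx' in Lx.
(* A lexicographic cone: the sign in K/L decides first, and [P0] decides inside L. *)
exists (P1 `|` (L `&` P0)); split; last first.
  move=> x xF; have [Lx|nLx] := boolP (x \in L).
    have [|P0x|P0x] := oP0 x; first by rewrite mem_filter Lx.
      by left; right; split=> //; apply: set_mem.
    by right; right; split=> //; apply: subgroupV => //; apply: set_mem.
  have [|P1x|P1x] := oP1 x; first by rewrite mem_filter nLx.
    by left; left.
  by right; left.
split.
- by move=> x [/P1L + /HL|[_ /P0H]].
- move=> x y [P1x|[Lx P0x]] [P1y|[Ly P0y]].
  + by left; apply: P1M.
  + by left; apply: (P1HM _ _ _ _).2.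
  + by left; apply: (P1HM _ _ _ _).1.
  by right; split; [apply: subgroupM|apply: P0M].
move=> h x Hh [P1x|[Lx P0x]].
  by have [] := P1HM h x (HL _ Hh) P1x; split; left.
have [? ?] := P0HM h x Hh P0x.
by split; right; split=> //; apply: subgroupM => //; apply: HL.
Qed.

(** * Central series with torsion-free factors *)

Section CentralSeries.
Variable T : groupType.
Implicit Types (H K N S : set T) (x y z : T) (s t : seq T).

Lemma commMgJ x y z : [~ x * y, z] = [~ x, z] ^ y * [~ y, z].
Proof.
by rewrite /commg /conjg !invgM -!mulgA !mulVKg.
Qed.

(** Such a series makes every quotient by a term torsion-free nilpotent. The terms need only
    intersect trivially, so the group itself need not be nilpotent. *)
Record tf_central_series (D : nat -> set T) : Prop := TFCentralSeries {
  tfc_top : forall x, D 0%N x;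
  tfc_subgroup : forall m, is_subgroup (D m);
  tfc_decr : forall m, D m.+1 `<=` D m;
  tfc_central : forall m x y, D m x -> D m.+1 [~ x, y];
  tfc_torsion : forall m x n, D m x -> 0 < n -> D m.+1 (x ^+ n) -> D m.+1 x;
  tfc_trivial : forall x, (forall m, D m x) -> x = 1
}.

Variable D : nat -> set T.
Hypothesis DP : tf_central_series D.
Let sD := tfc_subgroup DP.

Lemma tfc_normal m x y : D m x -> D m (x ^ y).
Proof.
move=> Dx; rewrite -[x ^ y](mulVKg x) -commgEl; apply: subgroupM => //.
exact/(tfc_decr DP)/(tfc_central DP).
Qed.

Lemma tfc_torsion_free x n : 0 < n -> x ^+ n = 1 -> x = 1.
Proof.
move=> n0 xn1; apply: (tfc_trivial DP) => m.
elim: m => [|m IHm]; first exact: (tfc_top DP).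
by apply: (tfc_torsion DP IHm n0); rewrite xn1; apply: subgroup1.
Qed.

Lemma tfc_expg_inj x y n : commute x y -> 0 < n -> x ^+ n = y ^+ n -> x = y.
Proof.
move=> cxy n0 eqxy; apply: divg1_eq; apply: (tfc_torsion_free n0).
by rewrite expgnFl // eqxy mulgV.
Qed.

(** Modulo [D m.+1] the commutator [x, y] is central, so [x^n, y] is congruent to [x, y]^n, and the
    torsion-free factor allows the root to be taken. *)
Lemma tfc_commg_root m x y n : 0 < n ->
  D m [~ x, y] -> D m.+1 [~ x ^+ n, y] -> D m.+1 [~ x, y].
Proof.
move=> n0 Dxy Dxny; apply: (tfc_torsion DP Dxy n0).
suff [d Dd xnyE] : exists2 d, D m.+1 d & [~ x ^+ n, y] = [~ x, y] ^+ n * d.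
  by apply: (subgroupMr (sD _) Dd); rewrite -xnyE.
elim: n {n0 Dxny} => [|n [d Dd IHn]].
  by exists 1; [apply: subgroup1|rewrite comm1g mulg1].
set u := [~ x ^+ n, y] in IHn.
have Du : D m u.
  rewrite IHn; apply: subgroupM => //; first exact: subgroupX.
  exact: (tfc_decr DP).
exists ((d * [~ u, x]) ^ [~ x, y]).
  exact: tfc_normal (subgroupM (sD _) Dd (tfc_central DP _ Du)).
rewrite expgSr commMgJ -/u; move: IHn; set c := [~ x, y].
move: (u) (c) => {Du}u {}c uE; rewrite expgSr /conjg -!mulgA mulVKg.
by rewrite (mulgA (c ^+ n)) -uE mulVKg.
Qed.

(** By induction on m, all commutators of K lie in [D m]. Then suitable powers of x and y are hc and
    kd with h, k in H and c, d in [D m]. Since h and k commute and c, d are central modulo [D m.+1],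
    these powers commute modulo [D m.+1], and taking roots twice yields [x, y]. *)
Lemma tfc_commute_of_isolated H K : is_subgroup K -> H `<=` K ->
  abelian_subgroup H ->
  (forall x, K x -> exists2 n, 0 < n &
     generated (H `|` [set z | exists x y, [/\ K x, K y & z = [~ x, y]]])
       (x ^+ n)) ->
  abelian_subgroup K.
Proof.
move=> sK HK [sH cH] isolK; split=> // x y Kx Ky.
apply/commgP/eqP/(tfc_trivial DP) => m.
elim: m x y Kx Ky => [|m IHm] x y Kx Ky; first exact: (tfc_top DP).
set N := generated _ in isolK.
(* The product of H and the normal subgroup [D m]; by the induction hypothesis it contains the
   commutators of K, hence N. *)
have sN : is_subgroup [set z | exists2 h, H h & D m (h^-1 * z)].
  apply/is_subgroupP; split.
    exists 1; first exact: subgroup1.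
    by rewrite mulVg; apply: subgroup1.
  move=> u v [h Hh Du] [k Hk Dv]; exists (h * k^-1).
    by apply: subgroupB.
  have -> : (h * k^-1)^-1 * (u * v^-1) = ((h^-1 * u) * (k^-1 * v)^-1) ^ k^-1.
    by rewrite /conjg !invgM !invgK -!mulgA mulgV mulg1.
  by apply: tfc_normal; apply: subgroupB.
have NE z : N z -> exists h c, [/\ H h, D m c & z = h * c].
  move=> /(generated_sub sN)[w [Hw|[u [v [Ku Kv ->]]]]|h Hh Dz].
  - by exists w => //; rewrite mulVg; apply: subgroup1.
  - exists 1; first exact: subgroup1.
    by rewrite invg1 mul1g; apply: IHm.
  by exists h, (h^-1 * z); rewrite mulVKg.
have [a a0 /NE[h [c [Hh Dc xE]]]] := isolK x Kx.
have [b b0 /NE[k [d [Hk Dd yE]]]] := isolK y Ky.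
have Dhkd : D m.+1 [~ h, k * d].
  rewrite -invgR; apply: subgroupV => //; rewrite commMgJ.
  have /commgP/eqP-> : commute k h by apply: cH.
  by rewrite conj1g mul1g; apply: (tfc_central DP).
have Dxy : D m.+1 [~ x ^+ a, y ^+ b].
  rewrite xE yE commMgJ; apply: subgroupM => //; first exact: tfc_normal.
  exact: (tfc_central DP).
have {}Dxy : D m.+1 [~ x, y ^+ b].
  by apply: tfc_commg_root Dxy => //; apply: IHm => //; apply: subgroupX.
rewrite -invgR; apply: subgroupV => //; apply: (tfc_commg_root b0).
  exact: IHm.
by rewrite -invgR; apply: subgroupV.
Qed.

End CentralSeries.

(** * Subgroups of finitely generated abelian groups *)

Section AbelianSubgroups.
Variable T : groupType.
Implicit Types (B H K S : set T) (x y z : T) (s t : seq T).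

Lemma generated_nil : generated [set` [::] : seq T] = [set 1].
Proof.
apply/seteqP; split=> [|_ ->]; last exact: generated1.
apply: generated_sub => //; apply/is_subgroupP.
by split=> // _ _ -> ->; rewrite mulgV.
Qed.

Lemma generated_cons a s x : abelian_subgroup (generated [set` a :: s]) ->
  generated [set` a :: s] x -> exists n y, generated [set` s] y /\
    (x = a ^+ n * y \/ x = a ^- n * y).
Proof.
move=> [sB cB] gx.
have sub_s : generated [set` s] `<=` generated [set` a :: s].
  apply: generated_sub => // z /= zs; apply: sub_generated => /=.
  by rewrite inE zs orbT.
have ga : generated [set` a :: s] a.
  by apply: sub_generated; rewrite /= inE eqxx.
(* The pair (n, m) encodes the integer n - m, so closure under division needs no case distinction on
   signs. *)
have sS : is_subgroup [set x | exists n m y, generated [set` s] y /\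
    x = a ^+ n * a ^- m * y].
  apply/is_subgroupP; split.
    exists 0%N, 0%N, 1; split; first exact: generated1.
    by rewrite invg1 !mulg1.
  move=> _ _ [n [m [y [gy ->]]]] [n' [m' [y' [gy' ->]]]].
  exists (n + m')%N, (n' + m)%N, (y / y'); split.
    have sgs := subgroup_generated [set` s].
    exact: (subgroupB sgs gy gy').
  have cy : commute a (y / y').
    apply: cB => //; apply: sub_s.
    have sgs := subgroup_generated [set` s].
    exact: (subgroupB sgs gy gy').
  have cz : commute (y / y') (a ^+ m' * a ^- n').
    by apply: commuteM; [|apply: commuteV]; apply/commuteX/commute_sym/cy.
  have cm : commute (a ^- m) (a ^+ m').
    by apply/commute_sym/commuteV/commuteX2.
  transitivity (a ^+ n * (a ^- m * (y / y' * (a ^+ m' * a ^- n')))).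
    by rewrite !invgM invgK -!mulgA.
  by rewrite cz !expgnDr invgM -!mulgA; congr (_ * _); rewrite !mulgA cm.
have [|n [m [y [gy ->]]]] := generated_sub sS _ gx.
  move=> z /=; rewrite inE => /predU1P[->|zs].
    exists 1%N, 0%N, 1; split; first exact: generated1.
    by rewrite invg1 !mulg1.
  by exists 0%N, 0%N, z; split; [apply: sub_generated|rewrite mulgV mul1g].
have [mn|/ltnW nm] := leqP m n.
  by exists (n - m)%N, y; split=> //; left; rewrite expgnFr.
by exists (m - n)%N, y; split=> //; right; rewrite expgnFr // invgM invgK.
Qed.

(** Induction on s: generators of S intersected with B' are completed by one element a^d y of S
    whose exponent d > 0 is minimal. *)
Lemma sub_generated_abelian s S : abelian_subgroup (generated [set` s]) ->
  is_subgroup S -> S `<=` generated [set` s] ->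
  exists2 t, size t = size s & S = generated [set` t].
Proof.
elim: s S => [|a s IHs] S abB sS SB.
  exists [::] => //; rewrite generated_nil in SB *.
  by apply/seteqP; split=> // _ ->; apply: subgroup1.
set B := generated [set` a :: s] in abB SB *.
pose B' := generated [set` s].
have sB' : is_subgroup B' by apply: subgroup_generated.
have [sB cB] := abB.
have B'B : B' `<=` B.
  apply: generated_sub => // z /= zs; apply: sub_generated => /=.
  by rewrite inE zs orbT.
have Ba : B a by apply: sub_generated; rewrite /= inE eqxx.
have abB' : abelian_subgroup B'.
  by split=> // x y /B'B Bx /B'B By; apply: cB.
have sSB' : is_subgroup (S `&` B').
  apply/is_subgroupP; split; first by split; apply: subgroup1.
  move=> x y [Sx Bx] [Sy By].
  by split; [apply: (subgroupB sS)|apply: (subgroupB sB')].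
have [t st SB'E] := IHs _ abB' sSB' (@subIsetr _ _ _).
have St : forall z, z \in t -> S z.
  move=> z zt; suff [] : (S `&` B') z by [].
  by rewrite SB'E; apply: sub_generated.
pose Q d := `[< 0 < d /\ exists2 y, B' y & S (a ^+ d * y) >].
have SE x : S x -> exists n y, B' y /\
    (x = a ^+ n * y \/ x^-1 = a ^+ n * y).
  move=> Sx; have [n [y [gy xE]]] := generated_cons abB (SB _ Sx).
  case: xE => ->; first by exists n, y; split=> //; left.
  exists n, y^-1; split; first exact: (subgroupV sB').
  right; rewrite invgM invgK; apply: cB; last exact: (subgroupX _ sB).
  exact: (subgroupV sB (B'B _ gy)).
clearbody B B'.
have [exQ|nQ] := pselect (exists d, Q d); last first.
  (* No positive exponent of a occurs, so S lies in B'; the generator 1 only pads the list to the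
     required length. *)
  exists (1 :: t); first by rewrite /= st.
  have SB' : S `<=` B'.
    move=> x Sx; have [[|n] [y [B'y xE]]] := SE x Sx.
      case: xE; rewrite mul1g => xE; first by rewrite xE.
      by rewrite -[x]invgK xE; apply: subgroupV.
    case: nQ; exists n.+1; apply/asboolP; split=> //; exists y => //.
    by case: xE => <- //; apply: subgroupV.
  have SE' : S = generated [set` t] by rewrite -SB'E; apply/esym/setIidPl.
  rewrite {1}SE'; apply/seteqP; split; apply: generated_sub;
    do ?exact: subgroup_generated.
    by move=> z zt; apply: sub_generated; rewrite /= inE; apply/orP; right.
  move=> z /=; rewrite inE => /predU1P[->|zt]; last exact: sub_generated.
  exact: generated1.
case: (ex_minnP exQ) => d /asboolP[d0 [y By Su]] dmin.
set u := a ^+ d * y in Su; exists (u :: t); first by rewrite /= st.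
have cay : commute a y by apply: cB => //; apply: B'B.
have sg := subgroup_generated [set` u :: t].
have gu : generated [set` u :: t] u.
  by apply: sub_generated; rewrite /= inE eqxx.
have SB'g : S `&` B' `<=` generated [set` u :: t].
  rewrite SB'E; apply: generated_sub => // z zt; apply: sub_generated => /=.
  by rewrite inE; apply/orP; right.
apply/seteqP; split; last first.
  by apply: generated_sub => // z /=; rewrite inE => /predU1P[->|/St].
suff pos x n z : S x -> B' z -> x = a ^+ n * z -> generated [set` u :: t] x.
  move=> x Sx; have [n [z [B'z []]]] := SE x Sx; first exact: pos.
  move=> xVE; rewrite -[x]invgK; apply: (subgroupV sg).
  by apply: pos xVE => //; apply: subgroupV.
(* Euclidean division: v has a-exponent n mod d, which minimality of d forces to be 0, so v lies in
   S and B'. *)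
move=> Sx B'z xE; pose v := x / u ^+ (n %/ d)%N.
have Sv : S v by apply: (subgroupB sS) => //; apply: subgroupX.
have vE : v = a ^+ (n %% d)%N * (z / y ^+ (n %/ d)%N).
  rewrite /v; set q := (n %/ d)%N; set r := (n %% d)%N.
  have Bdq : B (a ^+ d ^+ q) by do ?apply: (subgroupX _ sB).
  have Byq : B (y ^+ q) by apply: (subgroupX _ sB); apply: B'B.
  have nE : a ^+ n = a ^+ r * a ^+ d ^+ q.
    by rewrite (divn_eq n d) addnC expgnDr mulnC expgnA.
  rewrite xE nE /u expgMn; last exact/commute_sym/commuteX/commute_sym.
  rewrite invgM -!mulgA; congr (_ * _).
  have cz : commute (a ^+ d ^+ q) (z / y ^+ q).
    by apply: cB => //; apply: (subgroupB sB) => //; apply: B'B.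
  by rewrite (mulgA z) mulgA cz mulgK.
have B'v : B' (z / y ^+ (n %/ d)%N).
  by apply: (subgroupB sB') => //; apply: subgroupX.
have r0 : (n %% d)%N = 0%N.
  apply/eqP; rewrite -leqn0 leqNgt; apply/negP => r0.
  suff /dmin : Q (n %% d)%N by rewrite leqNgt ltn_mod d0.
  by apply/asboolP; split=> //; exists (z / y ^+ (n %/ d)%N); rewrite // -vE.
rewrite -[x](mulgVK (u ^+ (n %/ d)%N)); apply: (subgroupM sg).
  by apply: SB'g; split=> //; rewrite -/v vE r0 mul1g.
exact: (subgroupX _ sg).
Qed.

End AbelianSubgroups.

(** * Torsion extensions of abelian subgroups, and maximality *)

Section FiniteIndex.
Variables (T : groupType) (D : nat -> set T).
Hypothesis DP : tf_central_series D.
Implicit Types (H K : set T) (F : seq T).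

Lemma n_generatedP n H :
  n_generated n H <-> exists2 s : seq T, size s = n & H = generated [set` s].
Proof.
split=> [[s ->]|[s ss ->]]; first by exists s; rewrite ?size_tuple.
by exists (tcast ss (in_tuple s)); congr generated; apply/predeqP=> x /=;
  rewrite -[x \in tcast _ _]/(x \in tval _) val_tcast.
Qed.

(** For a common exponent N, the map x |-> x^N sends K into H and is injective, as K is abelian and
    roots are unique. Its image is n-generated, and N-th roots of generators of the image generate
    K. *)
Lemma n_generated_of_torsion n H F : let K := generated (H `|` [set` F]) in
  n_generated n H -> abelian_subgroup H -> abelian_subgroup K ->
  (forall x, x \in F -> exists2 k, 0 < k & H (x ^+ k)) -> n_generated n K.
Proof.
move=> K /n_generatedP[s ss HE] abH [sK cK] torF; have [sH _] := abH.
have [N N0 FN] : exists2 N, 0 < N & forall x, x \in F -> H (x ^+ N).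
  elim: F torF {K sK cK} => [|f F IHF] torF; first by exists 1%N.
  have [k k0 Hf] := torF f (mem_head _ _).
  have [x xF|N N0 HF] := IHF; first by apply: torF; rewrite inE xF orbT.
  exists (k * N)%N; first by rewrite muln_gt0 k0.
  move=> x; rewrite inE => /predU1P[->|xF].
    by rewrite expgnA; apply: subgroupX.
  by rewrite mulnC expgnA; apply: subgroupX => //; apply: HF.
have sub_im (L : set T) : is_subgroup L -> L `<=` K ->
    is_subgroup [set x ^+ N | x in L].
  move=> sL LK; apply/is_subgroupP; split.
    by exists 1; [apply: subgroup1|rewrite expg1n].
  move=> _ _ [x Lx <-] [y Ly <-]; exists (x / y).
    by apply: subgroupB.
  by rewrite expgnFl //; apply: cK; apply: LK.
have KN x : K x -> H (x ^+ N).
  move=> Kx; suff [] : [set x | K x /\ H (x ^+ N)] x by [].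
  have sKH : is_subgroup [set x | K x /\ H (x ^+ N)].
    apply/is_subgroupP; split.
      by split; [|rewrite expg1n]; apply: subgroup1.
    move=> y z [Ky Hy] [Kz Hz]; split; first exact: (subgroupB sK).
    rewrite expgnFl; last exact: cK.
    by apply: subgroupB.
  apply: (generated_sub sKH _ Kx) => y yHF.
  split; first exact: sub_generated.
  by case: yHF => [Hy|/FN//]; apply: subgroupX.
have [|||t st KNE] := @sub_generated_abelian _ s [set x ^+ N | x in K].
- by rewrite -HE.
- exact: sub_im.
- by rewrite -HE => _ [x Kx <-]; apply: KN.
have tP (z : T) : z \in t -> exists x, K x /\ x ^+ N = z.
  move=> zt; suff [x Kx xE] : [set x ^+ N | x in K] z by exists x.
  by rewrite KNE; apply: sub_generated.
(* A chosen N-th root in K for each generator of the image. *)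
pose r z := if pselect (exists x, K x /\ x ^+ N = z) is left ex then
  projT1 (cid ex) else 1.
have rP z : z \in t -> K (r z) /\ r z ^+ N = z.
  move=> /tP ex; rewrite /r; case: pselect => // ex'.
  exact: (projT2 (cid ex')).
apply/n_generatedP; exists (map r t); first by rewrite size_map st.
have rK : generated [set` map r t] `<=` K.
  by apply: generated_sub => // _ /mapP[z /rP[Kz _] ->].
apply/seteqP; split=> // x Kx.
suff [y gy xyE] : [set x ^+ N | x in generated [set` map r t]] (x ^+ N).
  rewrite (tfc_expg_inj DP _ N0 (esym xyE)) //.
  by apply: cK => //; apply: rK.
have : [set x ^+ N | x in K] (x ^+ N) by exists x.
rewrite KNE; apply: generated_sub.
  by apply: sub_im => //; apply: subgroup_generated.
move=> z zt; exists (r z); last by have [] := rP z zt.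
by apply: sub_generated; apply: map_f.
Qed.

Theorem left_relatively_convex_maximal_abelian n (G H : set T) :
  is_subgroup G -> maximal_n_generated_abelian G n H ->
  left_relatively_convex G H.
Proof.
move=> sG [[HG abH ngH] maxH]; have [sH cH] := abH.
apply: left_relatively_convex_local => //.
apply: locally_orientable_of_isolated => // F f fF FG K.
have sK : is_subgroup K by apply: subgroup_generated.
have HK : H `<=` K by move=> x Hx; apply: sub_generated; left.
have FK x : x \in F -> K x by move=> xF; apply: sub_generated; right.
have KG : K `<=` G by apply: generated_sub => // x [/HG//|/FG[]].
pose C := [set z | exists x y, [/\ K x, K y & z = [~ x, y]]].
pose N := generated (H `|` C).
have sN : is_subgroup N by apply: subgroup_generated.
have HN : H `<=` N by move=> x Hx; apply: sub_generated; left.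
have commN x y : K x -> K y -> N [~ x, y].
  by move=> Kx Ky; apply: sub_generated; right; exists x, y.
have NK : N `<=` K.
  apply: generated_sub => // _ [/HK//|[x [y [Kx Ky ->]]]].
  exact: (subgroupR sK Kx Ky).
pose L := [set x | K x /\ exists2 n, 0 < n & N (x ^+ n)].
have sL : is_subgroup L by apply: isolator_subgroup.
have NL : N `<=` L by move=> x Nx; split; [apply: NK|exists 1%N].
exists L; split=> //.
- by split=> [x /HN /NL|x []].
- by move=> x y Kx Ky; apply: NL (commN _ _ Kx Ky).
- move=> x k Kx k0 [_ [m m0 Nx]]; split=> //; exists (k * m)%N.
    by rewrite muln_gt0 k0.
  by rewrite expgnA.
apply: contrapT => nex.
have FL x : x \in F -> L x.
  by move=> xF; apply: contrapT => nLx; apply: nex; exists x.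
have KL : K `<=` L by apply: generated_sub => // x [/HN/NL//|/FL].
have abK : abelian_subgroup K.
  by apply: (tfc_commute_of_isolated DP sK HK abH) => x /KL[].
(* Once K is abelian, the commutators added to H are trivial, so elements of F have positive powers
   in H itself. *)
have NH : N `<=` H.
  apply: generated_sub => // _ [//|[x [y [Kx Ky ->]]]].
  have /commgP/eqP-> : commute x y by apply: abK.2.
  exact: subgroup1.
have ngK : n_generated n K.
  apply: n_generated_of_torsion => // x /FL[_ [k k0 /NH]].
  by exists k.
have KH : K = H by apply: maxH HK; split.
by have [_] := FG f fF; rewrite -KH; apply; apply: FK.
Qed.

End FiniteIndex.

Local Open Scope ring_scope.

(** * Central series from a unipotent action on a filtered abelian group *)

Section UnipotentAction.
Variables (T : groupType) (V : zmodType) (act : T -> V -> V).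
Variable van : nat -> set V.
Implicit Types (a b : T) (f g : V).
Hypothesis act1 : forall f, act 1%g f = f.
Hypothesis actM : forall a b f, act (a * b)%g f = act a (act b f).
Hypothesis actB : forall a f g, act a (f - g) = act a f - act a g.
Hypothesis van0 : forall j, van j 0.
Hypothesis vanB : forall j f g, van j f -> van j g -> van j (f - g).
Hypothesis van_decr : forall j f, van j.+1 f -> van j f.
Hypothesis van_torsion : forall j f n, (0 < n)%N -> van j (f *+ n) -> van j f.
Hypothesis van_top : forall f, van 0 f.
Hypothesis van_trivial : forall f, (forall j, van j f) -> f = 0.
Hypothesis van_act : forall a j f, van j f -> van j.+1 (act a f - f).
Hypothesis act_faithful : forall a, (forall f, act a f = f) -> a = 1%g.

(** The elements a for which a - 1 raises the filtration by m + 1. The successor makes [D 0] the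
    whole group, by [van_act]. *)
Let D m := [set a | forall j f, van j f -> van (j + m).+1 (act a f - f)].

Lemma vanN j f : van j f -> van j (- f).
Proof. by move=> vf; rewrite -sub0r; apply: vanB. Qed.

Lemma vanD j f g : van j f -> van j g -> van j (f + g).
Proof. by move=> vf vg; rewrite -[g]opprK; apply: vanB (vanN _). Qed.

Lemma van_leq i j f : (i <= j)%N -> van j f -> van i f.
Proof.
by move=> /subnKC <-; elim: (j - i)%N => [|k IHk];
  rewrite ?addn0 // addnS => /van_decr/IHk.
Qed.

Lemma van_stable a j f : van j f -> van j (act a f).
Proof.
by move=> vf; rewrite -[act a f](subrK f); apply/vanD/vf/van_decr/van_act.
Qed.

Lemma actVK a f : act a^-1%g (act a f) = f.
Proof. by rewrite -actM mulVg act1. Qed.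

Lemma tf_central_series_of_action : tf_central_series D.
Proof.
have sD m : is_subgroup (D m).
  apply/is_subgroupP; split=> [j f _|a b Da Db j f vf].
    by rewrite act1 subrr.
  set g := act b^-1%g f; have fE : f = act b g by rewrite -actM mulgV act1.
  have vg : van j g by apply: van_stable.
  have -> : act (a / b)%g f - f = (act a g - g) - (act b g - g).
    by rewrite actM -fE opprB addrA subrK.
  by apply: vanB; [apply: Da|apply: Db].
have decrD m : D m.+1 `<=` D m.
  by move=> a Da j f /Da; rewrite addnS => /van_decr.
split=> //.
- by move=> a j f /(van_act a); rewrite addn0.
- move=> m a b Da j f vf; set c := (b * a)%g.
  (* With u = a - 1 and v = b - 1 this is ab - ba = uv - vu. Here u raises the filtration by m + 1
     and v by 1, so both products raise it by m + 2. *)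
  have abE : act (a * b)%g f - act c f =
      (act a (act b f - f) - (act b f - f)) -
      (act b (act a f - f) - (act a f - f)).
    rewrite !actM !actB.
    have E (x y z w t : V) :
      x - y = x - z - (w - t) - (y - w - (z - t)).
      have subrBB (p q s : V) : p - s - (q - s) = p - q.
        by rewrite opprB addrA subrK.
      rewrite [in RHS](_ : x - z - (w - t) = x - w - (z - t)) ?subrBB //.
      by rewrite !opprD !opprK addrACA.
    exact: E.
  have -> : act [~ a, b]%g f - f = act c^-1%g (act (a * b)%g f - act c f).
    by rewrite actB actVK -actM /c invgM /commg /conjg -!mulgA.
  apply: van_stable; rewrite abE; apply: vanB.
    by rewrite addnS -addSn; apply/Da/van_act.
  by rewrite addnS; apply/van_act/Da.
- move=> m a n Da n0 Dan j f vf; apply: (van_torsion n0); rewrite addnS.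
  (* Up to order m + 2, a^n - 1 agrees with n(a - 1): each step of the induction adds an error (a^n
     - 1)(a - 1). *)
  suff vn : van (j + m).+2 ((act a f - f) *+ n - (act (a ^+ n)%g f - f)).
    rewrite -[X in van _ X](subrK (act (a ^+ n)%g f - f)); apply: vanD => //.
    by have := Dan j f vf; rewrite addnS.
  elim: n {n0 Dan} => [|n IHn]; first by rewrite act1 subrr subr0.
  have -> : (act a f - f) *+ n.+1 - (act (a ^+ n.+1)%g f - f) =
      ((act a f - f) *+ n - (act (a ^+ n)%g f - f)) -
      (act (a ^+ n)%g (act a f - f) - (act a f - f)).
    rewrite expgSr actM actB mulrSr.
    set p := act a f - f; rewrite (opprB _ p) addrACA -opprD.
    by congr (_ - _); rewrite [RHS]addrC addrA subrK.
  apply: vanB => //; apply: van_act; exact: Da.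
move=> a Da; apply: act_faithful => f; apply/eqP; rewrite -subr_eq0; apply/eqP.
apply: van_trivial => j; apply: van_leq (Da j 0%N f (van_top f)).
by rewrite add0n.
Qed.

End UnipotentAction.

(** * The Magnus action of a right-angled Artin group *)

Section Traces.
Variables (X : choiceType) (I : rel X).
Hypothesis I_sym : symmetric I.
Implicit Types (x y z : X) (u v w : seq X).

(* [pull x w] is the trace x^-1 w: the letter x is moved to the front of w
   by commutations and erased, and the result is [None] if this is impossible.
   Words are not identified up to commutation, as [pullC] holds on words. *)
Fixpoint pull x w : option (seq X) :=
  if w is y :: w' then
    if y == x then Some w'
    else if I x y then omap (cons y) (pull x w') else None
  else None.

Lemma pull_cons x w : pull x (x :: w) = Some w.
Proof. by rewrite /= eqxx. Qed.

Lemma pullC x y w : I x y -> x != y ->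
  obind (pull x) (pull y w) = obind (pull y) (pull x w).
Proof.
move=> Ixy neq_xy; have Iyx : I y x by rewrite I_sym.
have cons_pull a b (v : option (seq X)) : obind (pull a) (omap (cons b) v) =
    if b == a then v
    else if I a b then omap (cons b) (obind (pull a) v) else None.
  by case: v => [v|] /=; case: eqP => // _; case: (I a b).
elim: w => //= z w IHw; have [->|zx] := eqVneq z x.
  by rewrite (negPf neq_xy) Iyx /= cons_pull eqxx.
have [->|zy] := eqVneq z y; first by rewrite Ixy /= cons_pull eqxx.
case Iyz: (I y z); case Ixz: (I x z); rewrite ?cons_pull ?(negPf zx) ?(negPf zy)
  ?Iyz ?Ixz //=.
by rewrite IHw.
Qed.

Lemma size_pull x w u : pull x w = Some u -> size w = (size u).+1.
Proof.
elim: w u => //= y w IHw u; case: eqP => [_ [->] //|_].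
case: (I x y) => //; case E: (pull x w) => [v|] //= [<-] /=.
by rewrite (IHw v).
Qed.

(* No two occurrences of a letter can be brought together by commutations. *)
Fixpoint squarefree w : bool :=
  if w is x :: w' then (pull x w' == None) && squarefree w' else true.

(** By [pullC], if y could be pulled from the word left after removing x, it could already be pulled
    from the original word. *)
Lemma squarefree_pull x w u : squarefree w -> pull x w = Some u -> squarefree u.
Proof.
elim: w u => //= y w IHw u /andP[/eqP yw sw].
have [_ [<-] //|yx] := eqVneq y x; case Ixy: (I x y) => //.
case E: (pull x w) => [v|] //= [<-] /=; rewrite (IHw _ sw E) andbT.
have := pullC w Ixy; rewrite yw E eq_sym yx /= => <- //.
Qed.

(** Hence x^2 contributes nothing to coefficients at squarefree words, which truncates binomial
    series there. *)
Lemma squarefree_pull2 x w : squarefree w -> obind (pull x) (pull x w) = None.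
Proof.
elim: w => //= y w IHw /andP[/eqP yw sw]; have [<- //=|yx] := eqVneq y x.
have {IHw sw} := IHw sw; case: ifP => // Ixy.
by case: (pull x w) => //= v; rewrite (negPf yx) Ixy => ->.
Qed.

Local Notation V := (seq X -> int).
Implicit Types (f g : V).

(* On functions on traces, [shift x] is left multiplication of a formal power
   series by x, [magnus (x, true)] multiplication by 1 + x, and
   [magnus (x, false)] multiplication by its inverse. *)
Definition shift x f : V := fun w => oapp f 0 (pull x w).

(** Solves g + xg = f one coefficient at a time. Pulling x shortens the word by one letter, so its
    length is enough fuel. *)
Fixpoint unshift_rec x n f w : int :=
  f w - (if n is n'.+1 then oapp (unshift_rec x n' f) 0 (pull x w) else 0).

Definition unshift x f : V := fun w => unshift_rec x (size w) f w.

Definition magnus (a : X * bool) f : V :=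
  if a.2 then f + shift a.1 f else unshift a.1 f.

Lemma unshiftE x f w : unshift x f w = f w - shift x (unshift x f) w.
Proof.
rewrite /shift /unshift; case E: (pull x w) => [u|] /=; last first.
  by case: (size w) => [|n] /=; rewrite ?E.
by rewrite (size_pull E) /= E.
Qed.

Lemma size_ind (P : seq X -> Prop) :
  (forall w, (forall u, (size u < size w)%N -> P u) -> P w) -> forall w, P w.
Proof.
move=> IH w; have [n] := ubnP (size w); elim: n w => // n IHn w.
by rewrite ltnS => wn; apply: IH => u uw; apply: IHn; apply: leq_trans wn.
Qed.

Lemma shift_ext x f g w :
  (forall u, (size u < size w)%N -> f u = g u) -> shift x f w = shift x g w.
Proof.
rewrite /shift; case E: (pull x w) => [u|] //= fg.
by apply: fg; rewrite (size_pull E).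
Qed.

Lemma shiftB x f g : shift x (f - g) = shift x f - shift x g.
Proof.
apply/funext => w; rewrite /shift !fctE.
by case: (pull x w) => //=; rewrite subrr.
Qed.

Lemma shiftD x f g : shift x (f + g) = shift x f + shift x g.
Proof.
apply/funext => w; rewrite /shift !fctE.
by case: (pull x w) => //=; rewrite addr0.
Qed.

Lemma unshiftK x f : unshift x f + shift x (unshift x f) = f.
Proof. by apply/funext => w; rewrite !fctE unshiftE subrK. Qed.

(** A coefficient of xg involves only shorter words, so g is determined by induction on length. This
    makes [unshift] a two-sided inverse and additive. *)
Lemma unshift_uniq x f g : g + shift x g = f -> g = unshift x f.
Proof.
move=> <-; apply/funext; apply: size_ind => w IHw.
by rewrite unshiftE !fctE -(shift_ext x IHw) addrK.
Qed.

Lemma magnus_flip a f : magnus a (magnus (flip a) f) = f.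
Proof.
case: a => x [] /=; rewrite /magnus /=; first exact: unshiftK.
by apply/esym/unshift_uniq.
Qed.

Lemma magnusB a f g : magnus a (f - g) = magnus a f - magnus a g.
Proof.
case: a => x [] /=; rewrite /magnus /=.
  by rewrite shiftB opprD addrACA.
apply/esym/unshift_uniq; rewrite shiftB addrACA -opprD.
by rewrite !unshiftK.
Qed.

Definition vanishing j : set V :=
  [set f | forall w, (size w < j)%N -> f w = 0].

Lemma vanishingB j f g : vanishing j f -> vanishing j g -> vanishing j (f - g).
Proof. by move=> vf vg w wj; rewrite !fctE vf // vg // subrr. Qed.

Lemma vanishing_shift j x f : vanishing j f -> vanishing j.+1 (shift x f).
Proof.
move=> vf w wj; rewrite /shift; case E: (pull x w) => [u|] //=.
by apply: vf; rewrite -ltnS -(size_pull E).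
Qed.

Lemma vanishing_magnus j a f : vanishing j f -> vanishing j.+1 (magnus a f - f).
Proof.
case: a => x [] vf /=; rewrite /magnus /=.
  by rewrite addrC addKr; apply: vanishing_shift.
have vg : vanishing j (unshift x f).
  move=> w; elim/size_ind: w => w IHw wj; rewrite unshiftE vf // sub0r.
  rewrite (@shift_ext _ _ 0) => [|u uw]; last exact/IHw/ltn_trans/wj.
  by rewrite /shift; case: (pull x w) => //=; rewrite oppr0.
(* For g = (1 + x)^-1 f, the difference g - f equals -xg. *)
rewrite -{2}[f](unshiftK x) opprD addrA subrr sub0r.
by rewrite -sub0r; apply: vanishingB => //; apply: vanishing_shift.
Qed.

Lemma magnusC x y f : I x y ->
  magnus (x, true) (magnus (y, true) f) = magnus (y, true) (magnus (x, true) f).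
Proof.
have [-> //|xy Ixy] := eqVneq x y; rewrite /magnus /= !shiftD.
have -> : shift x (shift y f) = shift y (shift x f).
  apply/funext => w; rewrite /shift.
  have := pullC w Ixy xy.
  case: (pull x w) => [u|] /=; case: (pull y w) => [v|] //=.
  - by move=> ->.
  - by move=> <-.
  by move=> ->.
by rewrite addrACA !addrA.
Qed.

Definition free_act (w : free_group X) f : V := foldr magnus f w.

Lemma free_actM (g h : free_group X) f :
  free_act (g * h)%g f = free_act g (free_act h f).
Proof.
rewrite /free_act /=; elim: (free_word g) => //= a w <-.
case: (word_mul w h) => //= b v; case: eqP => [->|//].
by rewrite magnus_flip.
Qed.

Lemma free_actB (g : free_group X) f1 f2 :
  free_act g (f1 - f2) = free_act g f1 - free_act g f2.
Proof.
by rewrite /free_act; elim: (free_word g) => //= a w ->; rewrite magnusB.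
Qed.

Lemma vanishing_free_act (g : free_group X) j f :
  vanishing j f -> vanishing j.+1 (free_act g f - f).
Proof.
move=> vf; rewrite /free_act; elim: (free_word g) => [|a w IHw] /=.
  by rewrite subrr => u.
set h := foldr _ _ _ in IHw *.
have vh : vanishing j h.
  move=> u uj; have := IHw u (ltnW uj); rewrite !fctE => /eqP.
  by rewrite subr_eq0 vf // => /eqP.
have -> : magnus a h - f = (magnus a h - h) - (f - h).
  by rewrite opprB addrA subrK.
apply: vanishingB; first exact: vanishing_magnus.
move=> u uj; have /eqP := IHw u uj; rewrite !fctE subr_eq0 => /eqP->.
by rewrite subrr.
Qed.

End Traces.

(** * Integer powers in a group *)

Section IntegerPowers.
Variable T : groupType.
Implicit Types (x y : T) (e : int).

Definition expgz x e : T :=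
  match e with Posz n => (x ^+ n)%g | Negz n => (x ^- n.+1)%g end.

Lemma expgzS x e : expgz x (1 + e) = (x * expgz x e)%g.
Proof.
case: e => [n|[|n]] /=; first by rewrite expgS.
  by rewrite mulgV.
by rewrite [(x ^+ n.+2)%g]expgSr invgM mulVKg subn1.
Qed.

Lemma expgzP x e : expgz x (-1 + e) = (x^-1 * expgz x e)%g.
Proof.
by rewrite -{2}[e](subrK 1) [e - 1 + 1]addrC expgzS mulKg [e - 1]addrC.
Qed.

Lemma commute_expgz x y e e' :
  commute x y -> commute (expgz x e) (expgz y e').
Proof.
have cV (u v : T) (k : int) : commute u v -> commute u (expgz v k).
  by case: k => n cuv /=; [|apply: commuteV]; apply: commuteX.
by move=> cxy; apply/cV/commute_sym/cV/commute_sym.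
Qed.

End IntegerPowers.

(** * Faithfulness of the Magnus action through reduced products of syllables *)

Section RightAngledArtin.
Variables (A : groupType) (X : choiceType) (R : set (free_group X)).
Variable phi : {multiplicative free_group X -> A}.
Hypothesis R_comm :
  forall r, R r -> exists x y : X, r = [~ free_gen x, free_gen y]%g.
Hypothesis phi_surj : forall a : A, exists w, phi w = a.
Hypothesis phi_ker : [set w | phi w = 1%g] = normal_closure R.
Implicit Types (a b : A) (x y : X) (s t : seq (X * int)).

(** Symmetrized, since R may contain only one of the commutators [x, y] and [y, x]. *)
Let I : rel X := fun x y =>
  `[< R [~ free_gen x, free_gen y]%g \/ R [~ free_gen y, free_gen x]%g >].

Let I_sym : symmetric I.
Proof.
by move=> x y; apply/asboolP/asboolP => -[]; [right|left|right|left].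
Qed.

Local Notation V := (seq X -> int).
Implicit Types f : V.
Local Notation g x := (phi (free_gen x)).

Let phi1 : phi 1%g = 1%g.
Proof. by apply: (mulgI (phi 1%g)); rewrite -gmulfM !mulg1. Qed.

Let phiV w : phi w^-1%g = (phi w)^-1%g.
Proof. by apply: (mulgI (phi w)); rewrite -gmulfM !mulgV. Qed.

(** Words acting trivially form a normal subgroup, and it contains the relators by [magnusC]. The
    action thus descends to A. *)
Lemma kernel_free_act (w : free_group X) f : phi w = 1%g -> free_act I w f = f.
Proof.
have actM := @free_actM X I.
have act1 (f' : V) : free_act I 1%g f' = f' by [].
move=> phiw; suff : [set w | forall f, free_act I w f = f] w by apply.
suff /(_ w) : normal_closure R `<=` [set w | forall f, free_act I w f = f].
  by apply; rewrite -phi_ker.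
have actV (v : free_group X) :
    (forall f, free_act I v f = f) -> forall f, free_act I v^-1%g f = f.
  by move=> vf f'; rewrite -{1}[f']vf -actM mulVg.
apply: smallest_sub.
  split.
    apply/is_subgroupP; split=> // u v uf vf f'.
    by rewrite actM (actV v) // uf.
  move=> h v vf f'; rewrite /conjg !actM vf -actM mulVg.
  exact: act1.
move=> r /[dup] Rr /R_comm[x [y rE]] f'.
have genE z (f1 : V) : free_act I (free_gen z) f1 = magnus I (z, true) f1 by [].
have -> : r = ((free_gen y * free_gen x)^-1 * (free_gen x * free_gen y))%g.
  by rewrite rE invgM -mulgA.
rewrite actM actM !genE magnusC //; last by apply/asboolP; left; rewrite -rE.
by rewrite -!genE -(actM (free_gen y)) -actM mulVg.
Qed.

Definition artin_act a : V -> V := free_act I (projT1 (cid (phi_surj a))).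

Lemma artin_actE (w : free_group X) f : artin_act (phi w) f = free_act I w f.
Proof.
rewrite /artin_act; case: cid => v /= phiv.
rewrite -[v](mulVKg w) free_actM; congr free_act.
by apply: kernel_free_act; rewrite gmulfM phiV phiv mulVg.
Qed.

Lemma artin_act1 f : artin_act 1%g f = f.
Proof. by rewrite -phi1 artin_actE. Qed.

Lemma artin_actM a b f : artin_act (a * b)%g f = artin_act a (artin_act b f).
Proof.
have [[v <-] [w <-]] := (phi_surj a, phi_surj b).
by rewrite -gmulfM !artin_actE free_actM.
Qed.

Lemma artin_act_gen x f : artin_act (g x) f = f + shift I x f.
Proof. by rewrite artin_actE. Qed.

(* The binomial series of (1 + x)^e stops after two terms. *)
Lemma artin_act_expgz x e f w : obind (pull I x) (pull I x w) = None ->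
  artin_act (expgz (g x) e) f w = f w + shift I x f w *~ e.
Proof.
move=> pull2; have gE f' : artin_act (g x) f' w = f' w + shift I x f' w.
  by rewrite artin_act_gen.
(* At u, which is w with one x removed, no further x can be pulled, so powers of [g x] do not change
   the coefficient. *)
have sE e' : shift I x (artin_act (expgz (g x) e') f) w = shift I x f w.
  rewrite /shift; case E: (pull I x w) pull2 => [u|] //= Eu.
  have guE f' : artin_act (g x) f' u = f' u.
    by rewrite artin_act_gen !fctE /shift Eu addr0.
  elim/int_ind: e' => [|n IHn|n IHn]; first by rewrite artin_act1.
    by rewrite -addn1 addnC PoszD expgzS artin_actM guE.
  rewrite -guE -artin_actM -expgzS -IHn; congr (artin_act (expgz _ _) _ _).
  by rewrite -addn1 PoszD opprD addrC subrK.
elim/int_ind: e => [|n IHn|n IHn]; first by rewrite artin_act1 mulr0z addr0.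
  rewrite -addn1 addnC PoszD expgzS artin_actM gE sE IHn mulrzDr mulr1z.
  by rewrite addrAC addrA.
apply: (addIr (shift I x f w)); rewrite -{1}(sE (- (n.+1)%:Z)) -gE.
rewrite -artin_actM -expgzS.
have eE : 1 - (n.+1)%:Z = - n%:Z by rewrite -addn1 PoszD opprD addrC subrK.
rewrite eE IHn -addrA; congr (_ + _).
by rewrite -[X in _ = _ + X]mulr1z -mulrzDr addrC eE.
Qed.

Definition syllables s : A := foldr (fun p b => expgz (g p.1) p.2 * b)%g 1%g s.

Definition reduced_syllables s :=
  all (fun p : X * int => p.2 != 0) s && squarefree I (map fst s).

Lemma commute_gen x y : I x y -> commute (g x) (g y).
Proof.
have RK r : R r -> phi r = 1%g.
  move=> Rr; suff : [set w | phi w = 1%g] r by [].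
  by rewrite phi_ker; apply: sub_gen_smallest.
have phiR u v : phi [~ u, v]%g = [~ phi u, phi v]%g.
  by rewrite !gmulfM !phiV.
by case/asboolP => /RK; rewrite phiR => /eqP/commgP // /commute_sym.
Qed.

Lemma pull_syllables x s u : pull I x (map fst s) = Some u ->
  exists e s1 s2, [/\ s = s1 ++ (x, e) :: s2, u = map fst (s1 ++ s2)
    & forall p, p \in s1 -> I x p.1].
Proof.
elim: s u => //= -[y e] s IHs u /=; case: eqP => [-> [<-]|_].
  by exists e, [::], s.
case Ixy: (I x y) => //; case E: (pull I x _) => [v|] //= [<-].
have [e' [s1 [s2 [-> -> s1I]]]] := IHs _ E.
exists e', ((y, e) :: s1), s2; split=> // p; rewrite inE => /predU1P[->//|].
exact: s1I.
Qed.

Lemma syllables_cat s t : syllables (s ++ t) = (syllables s * syllables t)%g.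
Proof. by elim: s => [|p s IHs] /=; rewrite ?mul1g // IHs mulgA. Qed.

(** If x can be pulled to the front, its syllable absorbs the new letter, and is erased when the
    exponent becomes 0; otherwise a new syllable is added. *)
Lemma reduced_syllables_cons x (b : bool) s : reduced_syllables s ->
  exists2 t, reduced_syllables t &
    syllables t = (expgz (g x) (if b then 1 else -1)%R * syllables s)%g.
Proof.
set d : int := if b then 1 else -1; move=> /andP[nz sf].
have d0 : d != 0 by rewrite /d; case: (b).
have dE (z : A) e : expgz z (d + e) = (expgz z d * expgz z e)%g.
  by rewrite /d; case: (b); [rewrite expgzS|rewrite expgzP].
case E: (pull I x (map fst s)) => [u|]; last first.
  by exists ((x, d) :: s) => //; rewrite /reduced_syllables /= d0 nz E sf.
have [e [s1 [s2 [sE uE s1I]]]] := pull_syllables E.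
have cs1 e' : commute (expgz (g x) e') (syllables s1).
  elim: (s1) s1I => [|p t IHt] tI /=; first exact: commute1.
  apply: commuteM.
    by apply/commute_expgz/commute_gen/tI; rewrite inE eqxx.
  by apply: IHt => q qt; apply: tI; rewrite inE qt orbT.
have sylE : (expgz (g x) d * syllables s = syllables s1 *
    (expgz (g x) (d + e)%R * syllables s2))%g.
  by rewrite sE syllables_cat mulgA cs1 dE /= !mulgA.
have /and3P[nz1 _ nz2] : [&& all (fun p : X * int => p.2 != 0) s1, e != 0 &
    all (fun p : X * int => p.2 != 0) s2] by move: nz; rewrite sE all_cat.
have [de0|de0] := eqVneq (d + e) 0.
  exists (s1 ++ s2); last by rewrite sylE de0 syllables_cat mul1g.
  rewrite /reduced_syllables all_cat nz1 nz2 -uE.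
  exact: squarefree_pull E.
exists (s1 ++ (x, d + e) :: s2); last by rewrite sylE syllables_cat.
rewrite /reduced_syllables all_cat /= de0 nz1 nz2.
by move: sf; rewrite sE !map_cat.
Qed.

Lemma reduced_syllables_exist a :
  exists2 s, reduced_syllables s & syllables s = a.
Proof.
have [w <-] := phi_surj a; case: w => w rw.
elim: w rw => [|[x b] w IHw] rw.
  exists [::] => //=; rewrite -phi1; congr (phi _).
  exact/val_inj.
have rw' : reduced w by apply: path_sorted rw.
have [s rs sE] := IHw rw'.
have [t rt tE] := reduced_syllables_cons x b rs; exists t => //.
have gV : expgz (g x) (if b then 1 else -1) =
    phi (FreeGroup (isT : reduced [:: (x, b)])).
  case: b {rw tE} => //=; rewrite -phiV; congr (phi _).
  exact/val_inj.
rewrite tE sE gV -gmulfM; congr (phi _); apply/val_inj => /=.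
by case: w rw {rw' s rs sE t rt tE IHw} => //= c w /andP[/negPf->].
Qed.

(** The power series 1, on which a acts to give its Magnus image. *)
Let delta : V := fun w => (w == [::])%:Z.

(** At squarefree words each syllable acts as 1 + ex and supplies at most one letter. *)
Lemma syllables_act_long s w : squarefree I w -> (size s < size w)%N ->
  artin_act (syllables s) delta w = 0.
Proof.
elim: s w => [|[x e] s IHs] w sw ltsw /=.
  by rewrite artin_act1 /delta; case: w ltsw {sw}.
rewrite artin_actM artin_act_expgz ?squarefree_pull2 //.
rewrite IHs // ?(ltnW ltsw) // add0r /shift.
case E: (pull I x w) => [u|] /=; last by rewrite mul0rz.
rewrite IHs ?mul0rz //; first exact: squarefree_pull E.
by rewrite -ltnS -(size_pull E).
Qed.

(** The first syllable must contribute its term ex, as the remaining ones are too few to produce the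
    whole word; this multiplies the coefficient by e. *)
Lemma syllables_act_reduced s : reduced_syllables s ->
  artin_act (syllables s) delta (map fst s) != 0.
Proof.
elim: s => [|[x e] s IHs]; first by rewrite /= artin_act1.
case/andP => /= /andP[e0 nz] /andP[xs sf].
have sf' : squarefree I (x :: map fst s) by rewrite /= xs.
rewrite artin_actM artin_act_expgz ?squarefree_pull2 //.
rewrite syllables_act_long //=; last by rewrite size_map.
rewrite add0r /shift pull_cons /= mulrz_eq0 negb_or e0.
by apply: IHs; rewrite /reduced_syllables nz.
Qed.

Lemma artin_act_faithful a : (forall f, artin_act a f = f) -> a = 1%g.
Proof.
have [[|p s] rs <-] := reduced_syllables_exist a => // af.
(* The word of a nonempty product is nonempty, and [delta] is 0 there. *)
by have := syllables_act_reduced rs; rewrite af.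
Qed.

Lemma artin_tf_central_series : exists D : nat -> set A, tf_central_series D.
Proof.
eexists; apply: (@tf_central_series_of_action _ V artin_act (@vanishing X)).
- exact: artin_act1.
- exact: artin_actM.
- by move=> a f f'; apply: free_actB.
- by move=> j w _.
- exact: vanishingB.
- by move=> j f vf w wj; apply/vf/ltnW.
- move=> j f n n0 vf w wj; have /eqP := vf w wj.
  have -> : (f *+ n) w = f w *+ n.
    by elim: n {n0 vf} => // n IHn; rewrite !mulrS !fctE IHn.
  by rewrite mulrn_eq0 => /orP[/eqP n00|/eqP//]; rewrite n00 in n0.
- by [].
- by move=> f vf; apply/funext => w; apply: (vf (size w).+1).
- by move=> a j f; apply: vanishing_free_act.
exact: artin_act_faithful.
Qed.

End RightAngledArtin.

Theorem corollary28 (A : groupType) (G : set A) (n : nat) (H : set A) :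
  right_angled_artin A ->
  is_subgroup G ->
  maximal_n_generated_abelian G n H ->
  left_relatively_convex G H.
Proof.
move=> [X [R [R_comm [phi [phi_surj phi_ker]]]]] sG maxH.
have [D DP] := artin_tf_central_series R_comm phi_surj phi_ker.
exact (left_relatively_convex_maximal_abelian DP sG maxH).
Qed.
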